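(* For every $n\ge 1$, the Tamari lattice $T_n$ has characteristic polynomial $$\chi(T_n,t)=t^{\binom{n-1}{2}}\,(t-1)^{n-1}.$$
   Context: The Tamari lattice $T_n$ is the set of proper parenthesizations of the word $x_1x_2\cdots x_{n+1}$, partially ordered by letting $\sigma$ cover $\pi$ whenever $\pi=\ldots((AB)C)\ldots$ and $\sigma=\ldots(A(BC))\ldots$ for some subwords $A,B,C$. Equivalently (up to isomorphism), $T_n$ is the set of left bracket vectors under the component-wise order, where a left bracket vector is a vector $(v_1,\dots,v_n)$ of positive integers with $1\le v_i\le i$ for all $i$ and such that, with $S_i=\{v_i,v_i+1,\dots,i\}$, for any pair $S_i,S_j$ either one contains the other or $S_i\cap S_j=\emptyset$. The vector of a parenthesization is computed as follows: to find $v_i$, start at $x_i$ and move left, counting the number of $x$'s (including $x_i$) and of left parentheses passed until these two numbers are equal; then $v_i=j$ where $x_j$ is the last $x$ passed. Characteristic polynomial: let $L=T_n$ and take the maximal chain $\Delta$ in $T_n$ (in left bracket vector form) $$(1,\dots,1)<(1,2,1,\dots,1)<(1,2,2,1,\dots,1)<(1,2,3,1,\dots,1)<(1,2,3,2,1,\dots,1)<\cdots<(1,2,3,\dots,n),$$ whose elements are the vectors $(1,2,\dots,j-1,i,1,\dots,1)$ with $1\le i\le j\le n$; it has length $N=\binom n2$. Write $\Delta$ as $\hat 0=x_0<x_1<\cdots<x_N=\hat 1$ and let $A_i$ be the set of atoms $a$ of $T_n$ with $a\le x_i$, $a\not\le x_{i-1}$. The generalized rank $\rho(x)$ is the number of indices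 $i$ such that $A_i$ contains an atom $\le x$, and $$\chi(T_n,t)=\sum_{x\in T_n}\mu(\hat 0,x)\,t^{\,N-\rho(x)},$$ with $\mu$ the Möbius function of $T_n$. *)

(* Defs.v *)
From HB Require Import structures.
From mathcomp Require Import all_boot all_order all_algebra.
From mathcomp Require Import zify.

Set Implicit Arguments.
Unset Strict Implicit.
Unset Printing Implicit Defensive.

Import Order.TTheory GRing.Theory.
Local Open Scope order_scope.

Section FinitePosets.
Context {d : Order.disp_t} {T : finPOrderType d}.
Implicit Types x y z : T.

(* Well-founded recursion on the interval [x, y]; the fuel #|T| is always
   sufficient, see mobius_xx, mobius_lt and mobius_nle. *)
Fixpoint mobius_rec (k : nat) x y : int :=
  if k is k'.+1 then
    if x == y then 1%R
    else (- \sum_(z : T | (x <= z < y)%O) mobius_rec k' x z)%R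
  else 0%R.

Definition mobius x y : int := mobius_rec #|T| x y.

Lemma mobius_rec_stable k x y :
  (#|[pred z | (x <= z <= y)%O]| <= k)%N -> mobius_rec k x y = mobius x y.
Proof.
have step k1 : forall k2 x' y', (#|[pred z | (x' <= z <= y')%O]| <= k1)%N ->
    (#|[pred z | (x' <= z <= y')%O]| <= k2)%N ->
    mobius_rec k1 x' y' = mobius_rec k2 x' y'.
  elim: k1 => [|k1 IH] [|k2] x' y' //=.
  - rewrite leqn0 => /eqP /card0_eq e _; case: eqVneq => [exy|_].
      by have := e x'; rewrite !inE lexx exy lexx.
    by rewrite big1 ?oppr0 // => z /andP[xz /ltW zy]; have := e z;
      rewrite !inE xz zy.
  - move=> _; rewrite leqn0 => /eqP /card0_eq e; case: eqVneq => [exy|_].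
      by have := e x'; rewrite !inE lexx exy lexx.
    by rewrite big1 ?oppr0 // => z /andP[xz /ltW zy]; have := e z;
      rewrite !inE xz zy.
  - move=> h1 h2; case: eqVneq => // _; congr (- _)%R.
    apply: eq_bigr => z /andP[xz zy].
    suff lt_card : (#|[pred w | (x' <= w <= z)%O]| <
                    #|[pred w | (x' <= w <= y')%O]|)%N.
      by apply: IH; rewrite -ltnS; apply: leq_trans lt_card _.
    apply: proper_card; apply/properP; split.
      by apply/subsetP => w; rewrite !inE => /andP[-> /le_trans->] //; apply: ltW.
    by exists y'; rewrite !inE ?lexx ?(le_trans xz (ltW zy)) //= lt_geF // andbF.
by move=> hk; apply: step => //; apply: max_card.
Qed.

Lemma mobius_xx x : mobius x x = 1%R.
Proof.
rewrite -(@mobius_rec_stable #|T|.+1) /= ?eqxx //.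
exact: leq_trans (max_card _) (leqnSn _).
Qed.

Lemma mobius_lt x y :
  x < y -> mobius x y = (- \sum_(z : T | (x <= z < y)%O) mobius x z)%R.
Proof.
move=> ltxy; rewrite -(@mobius_rec_stable #|T|.+1) /= ?(lt_eqF ltxy) //.
exact: leq_trans (max_card _) (leqnSn _).
Qed.

Lemma mobius_nle x y : ~~ (x <= y) -> mobius x y = 0%R.
Proof.
move=> nxy; rewrite /mobius; case: #|T| => //= k; case: eqVneq => [e|_].
  by rewrite e lexx in nxy.
rewrite big1 ?oppr0 // => z /andP[xz /ltW zy].
by rewrite (le_trans xz zy) in nxy.
Qed.

End FinitePosets.

Section CharacteristicPolynomial.
Context {d : Order.disp_t} {T : finBPOrderType d}.
Implicit Types (x a z : T) (D : seq T).

Definition atom a : bool :=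
  (\bot < a) && [forall z : T, ~~ (\bot < z < a)].

(* D lists a maximal chain \bot = x_0 < x_1 < ... < x_N in increasing order;
   the sets A_i are indexed by 1 <= i <= N. *)
Definition atom_block D (i : nat) : {set T} :=
  [set a | [&& atom a, a <= nth \bot D i & ~~ (a <= nth \bot D i.-1)]].

Definition chain_length D : nat := (size D).-1.

Definition generalized_rank D x : nat :=
  count (fun i => [exists a in atom_block D i, a <= x])
        (iota 1 (chain_length D)).

Definition characteristic_poly D : {poly int} :=
  (\sum_(x : T)
     mobius \bot x *: 'X^(chain_length D - generalized_rank D x))%R.

End CharacteristicPolynomial.

(* Proper parenthesizations as binary trees: [Leaf] is a single letter and
   [Prod A B] is the word (AB), outermost parentheses included. *)
Inductive paren : Type := Leaf | Prod of paren & paren.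

Fixpoint paren_code (t : paren) : GenTree.tree unit :=
  if t is Prod l r then GenTree.Node 0 [:: paren_code l; paren_code r]
  else GenTree.Leaf tt.

Fixpoint paren_decode (g : GenTree.tree unit) : paren :=
  if g is GenTree.Node _ [:: l; r] then Prod (paren_decode l) (paren_decode r)
  else Leaf.

Lemma paren_codeK : cancel paren_code paren_decode.
Proof. by elim=> //= l -> r ->. Qed.

HB.instance Definition _ := Countable.copy paren (can_type paren_codeK).

Fixpoint letters (t : paren) : nat :=
  if t is Prod l r then letters l + letters r else 1.

Lemma letters_gt0 t : (0 < letters t)%N.
Proof. by elim: t => //= l IHl r _; rewrite addn_gt0 IHl. Qed.

(* [assoc_step s t]: t is obtained from s by replacing one occurrence of a
   subword ((AB)C) by (A(BC)), i.e. t covers s. *)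
Fixpoint assoc_step (s t : paren) : bool :=
  match s, t with
  | Prod l r, Prod l' r' =>
      [|| (if l is Prod a b then t == Prod a (Prod b r) else false),
          assoc_step l l' && (r == r')
        | (l == l') && assoc_step r r']
  | _, _ => false
  end.

Record tamari (n : nat) : Type :=
  Tamari { tamari_val :> paren; _ : letters tamari_val == n.+1 }.

HB.instance Definition _ n := [isSub for @tamari_val n].
HB.instance Definition _ n := [Countable of tamari n by <:].

Fixpoint parens (k : nat) : seq paren :=
  if k is k'.+1 then
    Leaf :: [seq Prod l r | l <- parens k', r <- parens k']
  else [::].

Lemma mem_parens k t : (letters t <= k)%N -> t \in parens k.
Proof.
elim: k t => [|k IH] [|l r] //=; first by have := letters_gt0 l; case: letters.
move=> h; rewrite in_cons /=; apply/allpairsP; exists (l, r) => /=.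
have := letters_gt0 l; have := letters_gt0 r.
by split=> //; apply: IH; lia.
Qed.

Definition tamari_enum n : seq (tamari n) := pmap insub (undup (parens n.+1)).

Lemma tamari_enum_uniq n : uniq (tamari_enum n).
Proof. exact/pmap_sub_uniq/undup_uniq. Qed.

Lemma mem_tamari_enum n : tamari_enum n =i predT.
Proof.
move=> t; rewrite mem_pmap_sub mem_undup.
by rewrite mem_parens // (eqP (valP t)).
Qed.

HB.instance Definition _ n := isFinite.Build (tamari n)
  (Finite.uniq_enumP (@tamari_enum_uniq n) (@mem_tamari_enum n)).

Definition tamari_le n : rel (tamari n) :=
  connect (fun s t : tamari n => assoc_step s t).

Fixpoint weight (t : paren) : nat :=
  if t is Prod l r then weight l + weight r + letters r else 0.

Lemma letters_assoc_step s t : assoc_step s t -> letters s = letters t.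
Proof.
elim: s t => [|l IHl r IHr] [|l' r'] //= /or3P[|/andP[/IHl-> /eqP->]|] //.
  by case: l {IHl} => // a b /eqP[-> ->] /=; rewrite addnA.
by case/andP=> /eqP-> /IHr->.
Qed.

Lemma weight_assoc_step s t : assoc_step s t -> (weight s < weight t)%N.
Proof.
elim: s t => [|l IHl r IHr] [|l' r'] //= /or3P[||].
- case: l {IHl} => // a b /eqP[-> ->] /=.
  have := letters_gt0 r; move: (letters r) (letters b) => x y.
  by move: (weight a) (weight b) (weight r) => *; lia.
- by case/andP=> /IHl lt /eqP->; rewrite !ltn_add2r.
- case/andP=> /eqP-> h; rewrite (letters_assoc_step h) ltn_add2r ltn_add2l.
  exact: IHr.
Qed.

Lemma tamari_le_weight n (s t : tamari n) :
  tamari_le s t -> s = t \/ (weight s < weight t)%N.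
Proof.
case/connectP=> p; elim: p s => [|u p IH] s /=; first by left.
case/andP=> /weight_assoc_step su /IH{}IH /IH[<-|ut]; right => //.
exact: ltn_trans su ut.
Qed.

Lemma tamari_le_refl n : reflexive (@tamari_le n).
Proof. by move=> t; apply: connect0. Qed.

Lemma tamari_le_trans n : transitive (@tamari_le n).
Proof. exact: connect_trans. Qed.

Lemma tamari_le_anti n : antisymmetric (@tamari_le n).
Proof.
move=> s t /andP[/tamari_le_weight[//|st] /tamari_le_weight[//|ts]].
by have := ltn_trans st ts; rewrite ltnn.
Qed.

Fact tamari_display : Order.disp_t. Proof. exact: Order.Disp tt tt. Qed.

HB.instance Definition _ n := Order.Le_isPOrder.Build tamari_display
  (tamari n) (@tamari_le_refl n) (@tamari_le_anti n) (@tamari_le_trans n).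

Fixpoint left_comb (n : nat) : paren :=
  if n is n'.+1 then Prod (left_comb n') Leaf else Leaf.

Lemma letters_left_comb n : letters (left_comb n) == n.+1.
Proof. by elim: n => //= n /eqP->; rewrite addn1. Qed.

Definition tamari_bot n : tamari n := Tamari (letters_left_comb n).

Lemma assoc_step_pred t :
  t = left_comb (letters t).-1 \/ exists2 s, assoc_step s t & letters s = letters t.
Proof.
elim: t => [|l IHl r IHr] /=; first by left.
case: r IHr => [|b c] IHr; last first.
  right; exists (Prod (Prod l b) c); first by rewrite /= eqxx.
  by rewrite /= addnA.
case: IHl => [el|[s sl es]]; last first.
  right; exists (Prod s Leaf); last by rewrite /= es.
  by rewrite /= sl eqxx orbT.
left; rewrite /= addn1 /= [in LHS]el.
by have := letters_gt0 l; case: (letters l).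
Qed.

Lemma tamari_le0x n (t : tamari n) : (tamari_bot n <= t)%O.
Proof.
have [k] := ubnP (weight t); elim: k t => // k IH t; rewrite ltnS => wt.
have lt : letters t = n.+1 := eqP (valP t).
have := assoc_step_pred t; rewrite lt.
case=> [et|[s st es]]; first by rewrite (_ : t = tamari_bot n) //; apply: val_inj.
pose s' := Tamari (introT eqP es).
apply: (@le_trans _ _ s'); last by apply: connect1.
by apply: IH; apply: leq_trans (weight_assoc_step st) wt.
Qed.

HB.instance Definition _ n :=
  Order.hasBottom.Build tamari_display (tamari n) (@tamari_le0x n).

Inductive token : Type := Lpar | Rpar | Letter of nat.

(* The word of t, its letters being numbered from k on. *)
Fixpoint word_from (k : nat) (t : paren) : seq token :=
  if t is Prod l r then
    Lpar :: word_from k l ++ word_from (k + letters l) r ++ [:: Rpar]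
  else [:: Letter k].

(* The tokens of w to the left of the letter x_i, listed from right to left,
   followed by acc. *)
Fixpoint left_of (i : nat) (acc w : seq token) : seq token :=
  match w with
  | [::] => [::]
  | Letter k :: w' => if k == i then acc else left_of i (Letter k :: acc) w'
  | s :: w' => left_of i (s :: acc) w'
  end.

(* Moving left through w, having passed nx letters, the last of which is x_j,
   and nl left parentheses. *)
Fixpoint walk (nx nl j : nat) (w : seq token) : nat :=
  if nx == nl then j else
  match w with
  | [::] => j
  | Lpar :: w' => walk nx nl.+1 j w'
  | Rpar :: w' => walk nx nl j w'
  | Letter k :: w' => walk nx.+1 nl k w'
  end.

Definition left_bracket_entry (t : paren) (i : nat) : nat :=
  walk 1 0 i (left_of i [::] (word_from 1 t)).

Definition left_bracket_vector n (t : tamari n) : seq nat :=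
  [seq left_bracket_entry t i | i <- iota 1 n].

Definition delta_vector (n j i : nat) : seq nat :=
  iota 1 j.-1 ++ i :: nseq (n - j) 1.

(* The vectors (1,...,j-1,i,1,...,1) without repetitions: for i = 1 < j this is
   the vector of the pair (j-1, j-1). *)
Definition delta_vectors (n : nat) : seq (seq nat) :=
  nseq n 1 :: [seq delta_vector n j i | j <- iota 2 n.-1, i <- iota 2 j.-1].

(* The elements of T_n with these vectors; none of them is lost by pmap, see
   left_bracket_vector_chain. *)
Definition delta_chain (n : nat) : seq (tamari n) :=
  pmap (fun v => [pick t : tamari n | left_bracket_vector t == v])
       (delta_vectors n).

(* The bracket vector read off the tree structure. *)
Fixpoint bracket_seq (k : nat) (t : paren) : seq nat :=
  if t is Prod l r then bracket_seq k l ++ k :: bracket_seq (k + letters l) r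
  else [::].

Lemma left_of_in k t i p w : (k <= i < k + letters t)%N ->
  left_of i p (word_from k t ++ w) = left_of i [::] (word_from k t) ++ p
with left_of_out k t i p w : ~~ (k <= i < k + letters t)%N ->
  left_of i p (word_from k t ++ w) = left_of i (rev (word_from k t) ++ p) w.
Proof.
- case: t => [|l r] /=; first by move=> h; rewrite (_ : k == i); [|lia].
  move=> h; rewrite -!catA.
  have [il|il] := ltnP i (k + letters l).
    by rewrite !left_of_in -?catA //; lia.
  by rewrite !(left_of_out k l) ?left_of_in -?catA ?cats0 //; lia.
- case: t => [|l r] /=; first by move=> h; case: eqP => [|//]; lia.
  move=> h; rewrite -!catA !left_of_out ?rev_cons; try lia.
  by rewrite !rev_cat -!cats1 -!catA.
Qed.

Lemma walk_stop m j w : walk m m j w = j.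
Proof. by case: w => [|[||k] w] /=; rewrite eqxx. Qed.

Lemma walk_rev k t nx nl j p : (nl < nx)%N ->
  walk nx nl j (rev (word_from k t) ++ p) =
  walk (nx + letters t) (nl + (letters t).-1) k p.
Proof.
elim: t k nx nl j p => [|l IHl r IHr] k nx nl j p h /=.
  by rewrite (gtn_eqF h) addn1 addn0.
have ll := letters_gt0 l; have lr := letters_gt0 r.
rewrite rev_cons !rev_cat /= -!cats1 -!catA /= (gtn_eqF h).
rewrite IHr // IHl /=; last by lia.
by rewrite ifN; [congr walk|]; lia.
Qed.

Lemma walk_word k t p :
  [seq walk 1 0 i (left_of i [::] (word_from k t) ++ p)
     | i <- iota k (letters t).-1] = bracket_seq k t /\
  walk 1 0 (k + (letters t).-1)
    (left_of (k + (letters t).-1) [::] (word_from k t) ++ p) =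
  walk (letters t) (letters t).-1 k p.
Proof.
elim: t k p => [|l IHl r IHr] k p /=; first by rewrite addn0 eqxx.
have ll := letters_gt0 l; have lr := letters_gt0 r.
have inl i : (k <= i < k + letters l)%N ->
    left_of i [:: Lpar] (word_from k l ++ word_from (k + letters l) r
      ++ [:: Rpar]) = left_of i [::] (word_from k l) ++ [:: Lpar].
  exact: left_of_in.
have inr i : (k + letters l <= i < k + letters l + letters r)%N ->
    left_of i [:: Lpar] (word_from k l ++ word_from (k + letters l) r
      ++ [:: Rpar]) = left_of i [::] (word_from (k + letters l) r)
      ++ rev (word_from k l) ++ [:: Lpar].
  by move=> h; rewrite left_of_out ?left_of_in -?catA //; lia.
split.
  have -> : (letters l + letters r).-1 =
    ((letters l).-1 + (letters r).-1.+1)%N by lia.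
  rewrite iotaD map_cat /=; congr (_ ++ _ :: _).
  - have [<- _] := IHl k (Lpar :: p).
    apply/eq_in_map => i; rewrite mem_iota => h.
    by rewrite inl -?catA //; lia.
  - rewrite inl -?catA /=; last by lia.
    have [_ ->] := IHl k (Lpar :: p) => /=.
    by rewrite ifN ?prednK ?walk_stop //; lia.
  - have -> : (k + (letters l).-1).+1 = (k + letters l)%N by lia.
    have [<- _] := IHr (k + letters l)%N (rev (word_from k l) ++ Lpar :: p).
    apply/eq_in_map => i; rewrite mem_iota => h.
    by rewrite inr -?catA //; lia.
have -> : (k + (letters l + letters r).-1 =
  k + letters l + (letters r).-1)%N by lia.
rewrite inr -?catA /=; last by lia.
have [_ ->] := IHr (k + letters l)%N (rev (word_from k l) ++ Lpar :: p).
rewrite walk_rev /=; last by lia.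
by rewrite ifN; [congr walk|]; lia.
Qed.

Lemma left_bracket_vectorE n (t : tamari n) :
  left_bracket_vector t = bracket_seq 1 t.
Proof.
have lt : letters t = n.+1 := eqP (valP t).
have [<- _] := walk_word 1 t [::]; rewrite lt.
by apply: eq_map => i; rewrite cats0.
Qed.

Lemma bracket_seq_inj k : injective (bracket_seq k).
Proof.
have lb k' t : all (fun v => k' <= v)%N (bracket_seq k' t).
  elim: t k' => //= l IHl r IHr k'; rewrite all_cat IHl /= leqnn /=.
  by apply: sub_all (IHr _) => v; lia.
have sz k' t : size (bracket_seq k' t) = (letters t).-1.
  elim: t k' => //= l IHl r IHr k'; rewrite size_cat /= IHl IHr.
  by have := letters_gt0 l; have := letters_gt0 r; lia.
have split (a b a' b' : seq nat) k' : k' \notin b -> k' \notin b' ->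
    a ++ k' :: b = a' ++ k' :: b' -> a = a' /\ b = b'.
  move=> kb kb'; elim: a a' => [|x a IH] [|x' a'] //=.
  - by case=> ->.
  - by case=> ? eb; move: kb; rewrite eb mem_cat mem_head orbT.
  - by case=> ? eb; move: kb'; rewrite -eb mem_cat mem_head orbT.
  - by case=> -> /IH[-> ->].
have notin k' l r : k' \notin bracket_seq (k' + letters l) r.
  apply/negP => /(allP (lb _ _)); have := letters_gt0 l; lia.
move=> t; elim: t k => [|l IHl r IHr] k [|l' r'] //=.
- by move/(congr1 size); rewrite size_cat /= addnS.
- by move/(congr1 size); rewrite size_cat /= addnS.
- case/split=> // /IHl <-{l'} eb.
  by congr Prod; apply: IHr eb.
Qed.

Lemma left_bracket_vector_inj n : injective (@left_bracket_vector n).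
Proof.
by move=> s t; rewrite !left_bracket_vectorE => /bracket_seq_inj /val_inj.
Qed.

Lemma delta_vector_ex n v : v \in delta_vectors n ->
  exists t : tamari n, left_bracket_vector t = v.
Proof.
have bL k m t : bracket_seq k (iter m (Prod^~ Leaf) t) =
    bracket_seq k t ++ nseq m k.
  elim: m => [|m IH]; first by rewrite cats0.
  by rewrite iterS /= IH -catA -(nseqD m 1) addn1.
have bR k m t : bracket_seq k (iter m (Prod Leaf) t) =
    iota k m ++ bracket_seq (k + m) t.
  elim: m k => [|m IH] k; first by rewrite addn0.
  by rewrite iterS /= addn1 IH addSnnS.
have lL m t : letters (iter m (Prod^~ Leaf) t) = (letters t + m)%N.
  by elim: m => [|m IH]; rewrite ?addn0 // iterS /= IH addn1 addnS.
have lR m t : letters (iter m (Prod Leaf) t) = (letters t + m)%N.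
  by elim: m => [|m IH]; rewrite ?addn0 // iterS /= IH add1n addnS.
rewrite in_cons => /orP[/eqP->|/allpairsPdep[j [i [hj hi ->]]]].
  have ht : letters (iter n (Prod^~ Leaf) Leaf) == n.+1 by rewrite lL add1n.
  by exists (Tamari ht); rewrite left_bracket_vectorE bL.
move: hj hi; rewrite !mem_iota => hj hi.
pose t := iter (n - j) (Prod^~ Leaf)
  (iter i.-1 (Prod Leaf) (Prod (iter (j - i) (Prod Leaf) Leaf) Leaf)).
have ht : letters t == n.+1 by rewrite lL lR /= lR /=; lia.
exists (Tamari ht); rewrite left_bracket_vectorE bL bR /= bR /= cats0.
have e1 : j.-1 = (i.-1 + (j - i))%N by lia.
have e2 : (1 + i.-1 = i)%N by lia.
by rewrite /delta_vector [in RHS]e1 iotaD e2 -!catA.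
Qed.

Lemma left_bracket_vector_chain n :
  [seq left_bracket_vector t | t <- delta_chain n] = delta_vectors n.
Proof.
rewrite /delta_chain; have := @delta_vector_ex n.
elim: (delta_vectors n) => //= v s IH h.
case: pickP => [t /eqP et|no] /=; last first.
  by have [t et] := h v (mem_head _ _); have := no t; rewrite et eqxx.
by rewrite et IH // => w ws; apply: h; rewrite in_cons ws orbT.
Qed.

Lemma chain_length_delta n : chain_length (delta_chain n) = 'C(n, 2).
Proof.
rewrite /chain_length -(size_map (@left_bracket_vector n)).
rewrite left_bracket_vector_chain /= size_allpairs_dep.
case: n => // n; rewrite [n.+1.-1]/=; elim: n => // n IH.
rewrite -(addn1 n) iotaD (addn1 n) map_cat sumn_cat IH /= size_iota.
by rewrite [RHS]binS bin1 addn0.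
Qed.

(* Main.v *)
Require Import Defs.
From mathcomp Require Import all_boot all_order all_algebra.
From mathcomp Require Import zify.
Import GRing.Theory.
Import Order.TTheory.

Set Implicit Arguments.
Unset Strict Implicit.
Unset Printing Implicit Defensive.

(** Write n = m + 1.  The atoms of T_n are the m vectors
    p_k = (1, ..., 1, k, 1, ..., 1) with k >= 2 in position k, and p_k lies
    below x exactly when v_k(x) = k, that is, when the k-th product of x
    in infix order has a single letter as its left factor.  Let At(x) be the
    set of atoms below x.

    The proof rests on a Galois connection between T_n and the Boolean lattice
    of sets of atoms: among the x with At(x) contained in B there is a greatest
    one, q(B), whose vector has v_i equal to the largest k <= i that is 1 or an
    index in B; moreover At(q(B)) = B and q(set0) is the bottom
    ([le_set_tree], [set_treeK], [set_tree0]).  Expanding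
    t = 1 + (t - 1) in t^(m - #|At(x)|) gives the sum of (t - 1)^(m - #|B|)
    over all B containing At(x), that is, over all B with x <= q(B).  After
    exchanging the sums, each B contributes (t - 1)^(m - #|B|), multiplied by
    the sum of mu(0, x) over x <= q(B), to the sum of the
    mu(0, x) t^(m - #|At(x)|).  The factor vanishes unless q(B) is the bottom,
    that is, unless B is empty, and what remains is (t - 1)^m ([sum_mobius_adjoint]).

    It remains to identify the generalized rank of x with #|At(x)|.  Along the
    given chain the atoms are picked up one at a time, so each block A_i has
    at most one element and every atom is in exactly one block; the rank is
    then a telescoping sum ([generalized_rank_At]).

    In terms of parenthesizations q(B) is a right comb whose left factors are
    left combs ([comb_row]), and the two order facts needed, x <= q(B) when
    At(x) is contained in B ([le_flag_tree]) and p_k <= x when k is in At(x)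
    ([atom_tree_le]), are proved by induction on the tree x. *)

(** * Characteristic polynomials and a Galois connection with a Boolean lattice *)

(** Each i outside A has a factor 1 + y, in which D contains i for the term 1
    and not for the term y; each i in A is given the factor 1 + 0, which forces
    it into D. *)
Lemma expr_supersets (R : comNzRingType) (I : finType) (y : R) (A : {set I}) :
  ((1 + y) ^+ #|~: A| = \sum_(D : {set I} | A \subset D) y ^+ #|~: D|)%R.
Proof.
have -> : ((1 + y) ^+ #|~: A| = \prod_i (1 + (i \notin A)%:R * y))%R.
  rewrite -prodr_const [RHS](bigID [in A]) /= [X in _ = (X * _)%R]big1 ?mul1r.
    by apply: eq_big => [i|i]; rewrite inE // => ->; rewrite mul1r.
  by move=> i ->; rewrite mul0r addr0.
rewrite bigA_distr [RHS]big_mkcond; apply: eq_big => // D _.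
case: ifPn => [/subsetP AD | /subsetPn[i iA iD]]; last first.
  by rewrite (bigD1 i) //= (negPf iD) iA mul0r mul0r.
rewrite -prodr_const (bigID [in D]) /= big1 ?mul1r => [|i ->//].
apply: eq_big => [i|i]; rewrite ?inE // => iD.
by rewrite (negPf iD) (contra (AD i) iD) mul1r.
Qed.

Section Adjunction.
Context {d : Order.disp_t} {T : finBPOrderType d} {I : finType}.
Variables (At : T -> {set I}) (q : {set I} -> T).
Hypothesis adj : forall x B, (x <= q B)%O = (At x \subset B).
Hypothesis qK : cancel q At.
Hypothesis q0 : q set0 = \bot%O.

Lemma sum_mobius_down (z : T) :
  (\sum_(x | (x <= z)%O) mobius \bot%O x = (z == \bot%O)%:R)%R.
Proof.
rewrite (bigD1 z) //=; case: eqVneq => [->|z0].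
  rewrite mobius_xx big1 ?addr0 // => x /andP[xz x0].
  by move: x0; rewrite eq_le xz le0x.
rewrite mobius_lt ?lt0x // addrC; apply/eqP; rewrite subr_eq0; apply/eqP.
by apply: eq_bigl => x; rewrite le0x lt_neqAle andbC.
Qed.

(** The powers of X - 1 are indexed by the D with At x \subset D, that is, by
    the D with x <= q D, so that the inner sums of the Moebius function run
    over principal down-sets. *)
Lemma sum_mobius_adjoint N : #|I| <= N ->
  (\sum_x mobius \bot%O x *: 'X^(N - #|At x|)
     = 'X^(N - #|I|) * ('X - 1) ^+ #|I| :> {poly int})%R.
Proof.
move=> IN; transitivity (\sum_x \sum_(D : {set I} | (x <= q D)%O)
    mobius \bot%O x *: ('X^(N - #|I|) * ('X - 1) ^+ #|~: D|) : {poly int})%R.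
  apply: eq_bigr => x _; under eq_bigl do rewrite adj.
  rewrite -scaler_sumr -mulr_sumr -expr_supersets addrC subrK -exprD.
  congr (_ *: 'X^_)%R; have := cardsC (At x); lia.
rewrite (exchange_big_dep predT) //= (bigD1 set0) //= [X in (_ + X)%R]big1.
  rewrite -scaler_suml sum_mobius_down q0 eqxx scale1r addr0.
  by rewrite setC0 cardsT.
move=> D D0; rewrite -scaler_suml sum_mobius_down -q0 (can_eq qK).
by rewrite (negPf D0) scale0r.
Qed.

Variable p : I -> T.
Hypothesis p_le : forall k x, (p k <= x)%O = (k \in At x).

Lemma At_mono x y : (x <= y)%O -> At x \subset At y.
Proof. by move=> xy; rewrite -adj (le_trans xy) // adj. Qed.

Lemma At_p k : At (p k) = [set k].
Proof.
by apply/eqP; rewrite eqEsubset sub1set -p_le lexx -adj p_le qK set11.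
Qed.

Lemma gt0_At x : (\bot < x)%O -> exists k, k \in At x.
Proof.
move=> x0; apply/set0Pn; apply: contraTneq x0 => e.
by rewrite lt0x negbK -lex0 -q0 adj e sub0set.
Qed.

(** A non-bottom x has some k in At x, since At x = set0 would give
    x <= q set0; hence p k <= x, and the p k are all the minimal non-bottom
    elements. *)
Lemma atomP a : reflect (exists k, a = p k) (atom a).
Proof.
have p0 k : (\bot < p k)%O.
  rewrite lt0x; apply/eqP => e.
  by have := At_p k; rewrite e -q0 qK => /setP/(_ k); rewrite !inE eqxx.
apply: (iffP andP) => [[/gt0_At[k ka] /forallP na] | [k ->]].
  exists k; apply/eqP; rewrite eq_sym eq_le p_le ka /=.
  have := na (p k); rewrite p0 /= lt_neqAle p_le ka andbT negbK.
  by move/eqP->.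
split=> //; apply/forallP => z; apply/negP => /andP[/gt0_At[j jz] zk].
have /subsetP/(_ _ jz) := At_mono (ltW zk); rewrite At_p => /set1P ej.
by move: zk; rewrite lt_neqAle eq_le p_le -ej jz andbT andNb.
Qed.

Lemma atom_block_below D i x :
  [exists a in atom_block D i, (a <= x)%O] =
  (At x :&: At (nth \bot%O D i) :\: At (nth \bot%O D i.-1) != set0).
Proof.
apply/existsP/set0Pn => [[a]|[k]].
  rewrite inE => /andP[/and3P[/atomP[k ->]]]; rewrite !p_le => ki nki kx.
  by exists k; rewrite !inE nki kx.
rewrite !inE => /and3P[nki kx ki]; exists (p k).
by rewrite inE !p_le kx ki nki !andbT; apply/atomP; exists k.
Qed.

(** Since At grows by at most one element at each step of D, the indicator of
    a block with an atom below x is the increment of the number of elements of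
    At x already collected, and these increments telescope. *)
Lemma generalized_rank_At (D : seq T) x :
  At (nth \bot%O D 0) = set0 ->
  At (nth \bot%O D (chain_length D)) = setT ->
  (forall i, i < chain_length D ->
     At (nth \bot%O D i) \subset At (nth \bot%O D i.+1) /\
     #|At (nth \bot%O D i.+1) :\: At (nth \bot%O D i)| <= 1) ->
  generalized_rank D x = #|At x|.
Proof.
move=> D0 DN step; pose f i := #|At x :&: At (nth \bot%O D i)|.
have f0 : f 0 = 0 by rewrite /f D0 setI0 cards0.
have fN : f (chain_length D) = #|At x| by rewrite /f DN setIT.
rewrite -fN -[RHS]subn0 -f0 -telescope_sumn_in //; last first.
  by move=> i /step[sub _]; apply/subset_leq_card/setIS.
rewrite /generalized_rank -sum1_count big_mkcond /= -[1]addn0 iotaDl big_map.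
rewrite /index_iota subn0 !big_seq; apply: eq_bigr => i.
rewrite mem_iota add0n => /step[sub le1].
rewrite atom_block_below add1n.
have -> : f i.+1 =
    f i + #|At x :&: At (nth \bot%O D i.+1) :\: At (nth \bot%O D i)|.
  rewrite addnC /f -(cardsID (At (nth \bot%O D i))) addnC -setIA.
  by rewrite (setIidPr sub).
rewrite addKn /=.
have : #|At x :&: At (nth \bot%O D i.+1) :\: At (nth \bot%O D i)| <= 1.
  by apply: leq_trans le1; apply/subset_leq_card/setSD/subsetIr.
by rewrite -card_gt0; case: #|_| => [|[]].
Qed.

End Adjunction.

(** * The Tamari order on parenthesizations of all sizes *)

(** The same order as on [tamari n], without the bound on the size, so that
    it passes to the factors of a product. *)
Inductive assoc_le (s : paren) : paren -> Prop :=
| assoc_le_refl : assoc_le s s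
| assoc_le_step t u : assoc_le s t -> assoc_step t u -> assoc_le s u.

Lemma assoc_le_trans s t u : assoc_le s t -> assoc_le t u -> assoc_le s u.
Proof. by move=> st; elim=> // v w _ sv vw; apply: assoc_le_step sv vw. Qed.

Lemma assoc_le_rot a b c : assoc_le (Prod (Prod a b) c) (Prod a (Prod b c)).
Proof.
by apply: assoc_le_step (assoc_le_refl _) _; rewrite /= eqxx.
Qed.

Lemma assoc_le_prod a a' b b' :
  assoc_le a a' -> assoc_le b b' -> assoc_le (Prod a b) (Prod a' b').
Proof.
move=> aa bb; apply: (@assoc_le_trans _ (Prod a' b)).
  elim: aa => [|t u _ IH tu]; first exact: assoc_le_refl.
  by apply: assoc_le_step IH _; rewrite /= tu eqxx orbT.
elim: bb => [|t u _ IH tu]; first exact: assoc_le_refl.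
by apply: assoc_le_step IH _; rewrite /= tu eqxx !orbT.
Qed.

Lemma tamari_leP n (x y : tamari n) : reflect (assoc_le x y) (x <= y)%O.
Proof.
apply: (iffP idP) => [/connectP[p]|xy].
  elim/last_ind: p y => [|p z IH] y /=; first by move=> _ ->; left.
  rewrite rcons_path last_rcons => /andP[/IH/(_ erefl) xl lz] ->.
  exact: assoc_le_step xl lz.
move et: (y : paren) xy => t xy.
elim: xy y et => [|t' u _ IH tu] y et; first by rewrite (val_inj et).
have ht : letters t' == n.+1.
  by rewrite (letters_assoc_step tu) -et; apply: (valP y).
apply: (le_trans (IH (Tamari ht) erefl)); apply: connect1.
by rewrite /= et.
Qed.

Definition add_letters m : paren -> paren := iter m (Prod^~ Leaf).

Lemma letters_add_letters m t : letters (add_letters m t) = letters t + m.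
Proof. by elim: m => [|m IH]; rewrite ?addn0 //= IH addn1 addnS. Qed.

Lemma add_lettersD m k t :
  add_letters (m + k) t = add_letters m (add_letters k t).
Proof. exact: iterD. Qed.

Lemma left_combE m : left_comb m = add_letters m Leaf.
Proof. by elim: m => //= m ->. Qed.

Lemma add_letters_mono m s t :
  assoc_le s t -> assoc_le (add_letters m s) (add_letters m t).
Proof.
by move=> st; elim: m => //= m IH; apply: assoc_le_prod IH (assoc_le_refl _).
Qed.

Lemma add_letters_le_Prod a t : assoc_le (add_letters (letters t) a) (Prod a t).
Proof.
elim: t a => [|l IHl r IHr] a; first exact: assoc_le_refl.
rewrite [letters _]/= addnC add_lettersD.
apply: assoc_le_trans (assoc_le_rot _ _ _).
exact: assoc_le_trans (add_letters_mono _ (IHl a)) (IHr _).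
Qed.

Lemma add_letters_Prod m a t :
  assoc_le (add_letters m (Prod a t)) (Prod a (add_letters m t)).
Proof.
elim: m => [|m IH] /=; first exact: assoc_le_refl.
apply: assoc_le_trans (assoc_le_rot _ _ _).
exact: assoc_le_prod IH (assoc_le_refl _).
Qed.

Lemma left_comb_le t : assoc_le (left_comb (letters t).-1) t.
Proof.
elim: t => [|l IHl r IHr]; first exact: assoc_le_refl.
have -> : (letters (Prod l r)).-1 = letters r + (letters l).-1.
  by have := letters_gt0 l; rewrite /=; lia.
rewrite left_combE add_lettersD -left_combE.
apply: assoc_le_trans (add_letters_le_Prod _ _) _.
exact: assoc_le_prod IHl (assoc_le_refl _).
Qed.

(** * The single-letter left factors of a parenthesization *)

(** One flag for each product of t, in infix order; it tells whether v_k = k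
    in the left bracket vector of t. *)
Fixpoint left_leaves (t : paren) : seq bool :=
  if t is Prod l r then left_leaves l ++ (l == Leaf) :: left_leaves r else [::].

Lemma size_left_leaves t : size (left_leaves t) = (letters t).-1.
Proof.
elim: t => //= l IHl r IHr; rewrite size_cat /= IHl IHr.
by have := letters_gt0 l; have := letters_gt0 r; lia.
Qed.

Lemma left_leaves_Prod l r : exists s, left_leaves (Prod l r) = true :: s.
Proof.
elim: l r => [|l IHl r' _] r; first by exists (left_leaves r).
by have [s /= ->] := IHl r'; exists (s ++ false :: left_leaves r).
Qed.

Definition below_flags s t := all2 implb s t.

Lemma below_flags_nth s t : below_flags s t =
  (size s == size t) &&
  all (fun i => nth false s i ==> nth false t i) (iota 0 (size s)).
Proof.
elim: s t => [|b s IH] [|c t] //=.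
by rewrite IH eqSS -[1]addn0 iotaDl all_map /= andbCA.
Qed.

Lemma below_flags_refl s : below_flags s s.
Proof. by elim: s => //= b s ->; case: b. Qed.

Lemma below_flags_trans : transitive below_flags.
Proof.
move=> t s u; elim: s t u => [|a s IH] [|b t] [|c u] //=.
case/andP=> ab /IH st /andP[bc /st->]; move: ab bc.
by case: a; case: b; case: c.
Qed.

Lemma below_flags_cat s s' t t' :
  below_flags s s' -> below_flags t t' -> below_flags (s ++ t) (s' ++ t').
Proof. by elim: s s' => [|b s IH] [|c s'] //= /andP[-> /IH h] /h. Qed.

(** Passing from (AB)C to A(BC) only changes the flag of the product with C:
    its left factor AB, never a letter, becomes B. *)
Lemma left_leaves_step s t :
  assoc_step s t -> below_flags (left_leaves s) (left_leaves t).
Proof.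
elim: s t => [|l IHl r IHr] [|l' r'] //= /or3P[||].
- case: l {IHl} => // a b /eqP[-> ->] /=; rewrite -catA /=.
  apply: below_flags_cat; first exact: below_flags_refl.
  rewrite /= implybb; apply: below_flags_cat; exact: below_flags_refl.
- case/andP=> ll /eqP->; apply: below_flags_cat; first exact: IHl.
  by case: l ll {IHl} => //= a b; case: l' => // a' b' _;
    apply: below_flags_refl.
- case/andP=> /eqP-> rr; apply: below_flags_cat; first exact: below_flags_refl.
  by rewrite /= implybb; apply: IHr.
Qed.

Lemma left_leaves_mono s t :
  assoc_le s t -> below_flags (left_leaves s) (left_leaves t).
Proof.
elim=> [|u v _ IH /left_leaves_step]; first exact: below_flags_refl.
exact: below_flags_trans.
Qed.

(** * The greatest parenthesization with given flags *)

(** The right comb with last factor r whose left factors are left combs (on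
    top of l for the first one): a flag true starts a new left comb, a flag
    false adds a letter to the current one. *)
Fixpoint comb_row (r l : paren) (s : seq bool) : paren :=
  match s with
  | [::] => Prod l r
  | true :: s' => Prod l (comb_row r Leaf s')
  | false :: s' => comb_row r (Prod l Leaf) s'
  end.

Lemma left_leaves_comb_row r l s :
  left_leaves (comb_row r l s)
  = left_leaves l ++ (l == Leaf) :: s ++ left_leaves r.
Proof.
by elim: s l => [|[] s IH] l //=; rewrite IH //= -catA.
Qed.

Lemma letters_comb_row r l s :
  letters (comb_row r l s) = letters l + size s + letters r.
Proof. by elim: s l => [|[] s IH] l //=; rewrite ?IH /=; lia. Qed.

Lemma comb_row_cat r l s s' :
  comb_row r l (s ++ true :: s') = comb_row (comb_row r Leaf s') l s.
Proof. by elim: s l => [|[] s IH] l //=; rewrite IH. Qed.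

Lemma comb_row_nseq_false r l m :
  comb_row r l (nseq m false) = Prod (add_letters m l) r.
Proof.
by elim: m l => //= m IH l; rewrite IH -[Prod l _]/(add_letters 1 l)
  -add_lettersD addn1.
Qed.

(** The flag c belongs to the product with r.  For c = false, r can only be
    moved inside as far as the last left comb; for c = true it is moved one
    level further. *)
Lemma Prod_comb_row_le r l s c :
  assoc_le (Prod (comb_row Leaf l s) r) (comb_row r l (rcons s c)).
Proof.
elim: s l => [|[] s IH] l /=; last exact: IH.
  by case: c; [apply: assoc_le_rot | apply: assoc_le_refl].
apply: assoc_le_trans (assoc_le_rot _ _ _) _.
exact: assoc_le_prod (assoc_le_refl _) (IH _).
Qed.

(** The first product always has a letter as its left factor, so the first
    flag of s carries no information. *)
Definition flag_tree (s : seq bool) : paren :=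
  if s is _ :: s' then comb_row Leaf Leaf s' else Leaf.

(** For t = Prod l r the flags s split into those of l, that of the root and
    those of r.  By induction l and r lie below the trees of their flags, and
    the product of these two trees lies below the tree of s: it is equal to it
    if l is a letter, and [Prod_comb_row_le] applies otherwise. *)
Lemma le_flag_tree t s :
  below_flags (left_leaves t) s -> assoc_le t (flag_tree s).
Proof.
have spl u v w : below_flags (u ++ v) w -> exists w1 w2,
    [/\ w = w1 ++ w2, below_flags u w1 & below_flags v w2].
  elim: u w => [|b u IH] w /=; first by exists [::], w.
  by case: w => //= c w /andP[bc /IH[w1 [w2 [-> ? ?]]]];
    exists (c :: w1), w2; rewrite /= bc.
(* The flags sr of a right factor are empty or start with true, which allows
   to cut the row of combs just before them. *)
have joint l sr : sr = [::] \/ (exists s', sr = true :: s') -> forall sa c,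
    assoc_le (Prod (comb_row Leaf l sa) (flag_tree sr))
             (comb_row Leaf l (rcons sa c ++ sr)).
  case=> [->|[s' ->]] sa c; last first.
    by rewrite comb_row_cat; apply: Prod_comb_row_le.
  by rewrite cats0; apply: Prod_comb_row_le.
elim: t s => [|l IHl r IHr] s; first by case: s => // _; apply: assoc_le_refl.
rewrite -[left_leaves _]/(left_leaves l ++ (l == Leaf) :: left_leaves r).
move=> /spl[sl [[|c sr] [-> lsl]]] // /andP[lc rsr].
have hr : sr = [::] \/ exists s', sr = true :: s'.
  case: r rsr {IHr} => [|a b]; first by case: sr; left.
  have [s' ->] := left_leaves_Prod a b.
  by case: sr => // [] [] // sr _; right; exists sr.
have {IHl} := IHl _ lsl; have {IHr} := IHr _ rsr.
case: l lsl lc => [|a b] lsl lc hb ha.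
  case: sl lsl ha => // _ _.
  apply: assoc_le_trans (assoc_le_prod (assoc_le_refl _) hb) _.
  by case: hr => [->|[s' ->]]; apply: assoc_le_refl.
have [s' es] := left_leaves_Prod a b; move: lsl; rewrite es.
case: sl ha => //= b' sl ha _.
apply: assoc_le_trans (assoc_le_prod ha hb) _.
by rewrite -cat_rcons; apply: joint.
Qed.

(** * The atoms *)

(** The parenthesization of m + 1 letters with bracket vector
    (1, ..., 1, i + 1, 1, ..., 1); positions are numbered from 0 here. *)
Definition atom_tree m i : paren :=
  add_letters (m - i.+1) (Prod (left_comb i.-1) (Prod Leaf Leaf)).

Lemma nth_left_leaves_atom_tree m i :
  0 < i -> nth false (left_leaves (atom_tree m i)) i.
Proof.
move=> i0; rewrite /atom_tree; elim: (m - i.+1) => [|k IH] /=.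
  rewrite nth_cat size_left_leaves (eqP (letters_left_comb _)) /=.
  by rewrite ifN; [have -> : i - i.-1 = 1 by lia | lia].
by rewrite nth_cat; case: ltnP => // h; move: IH; rewrite nth_default.
Qed.

Lemma letters_atom_tree m i : 0 < i < m -> letters (atom_tree m i) = m.+1.
Proof.
by move=> h; rewrite letters_add_letters /= (eqP (letters_left_comb _)); lia.
Qed.

(** If product i lies in the left factor l, the letters after l can be moved
    out of r one by one.  If it lies in r, everything of r after that product
    can be moved out in the same way, and what precedes it flattens to a left
    comb. *)
Lemma atom_tree_le t i : 0 < i -> nth false (left_leaves t) i ->
  assoc_le (atom_tree (letters t).-1 i) t.
Proof.
elim: t i => [|l IHl r IHr] i i0 /=; first by rewrite nth_nil.
have l0 := letters_gt0 l; have r0 := letters_gt0 r.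
rewrite nth_cat size_left_leaves; case: ltnP => [il /IHl{}IHl|li].
  apply: assoc_le_trans (assoc_le_prod (IHl i0) (assoc_le_refl r)).
  apply: assoc_le_trans (add_letters_le_Prod _ _).
  rewrite /atom_tree -add_lettersD.
  have -> : (letters l + letters r).-1 - i.+1 =
    letters r + ((letters l).-1 - i.+1) by lia.
  exact: assoc_le_refl.
case E: (i - (letters l).-1) => [|j] /=.
  by move/eqP=> el; move: E; rewrite el /=; lia.
move=> rj; have jr : j < (letters r).-1.
  by rewrite -size_left_leaves; case: ltnP rj => // h; rewrite nth_default.
set LL := Prod Leaf Leaf.
(* c is the part of r that is left once the letters after product i are moved
   out: two letters x x if product i is the first one of r, otherwise a left
   comb times (x x). *)
suff [c cr lc] : exists2 c,
    assoc_le (add_letters ((letters r).-1 - j.+1) c) r &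
    assoc_le (Prod (left_comb i.-1) LL) (Prod l c).
  apply: assoc_le_trans (assoc_le_prod (assoc_le_refl l) cr).
  apply: assoc_le_trans (add_letters_Prod _ _ _).
  have -> : (letters r).-1 - j.+1 = (letters l + letters r).-1 - i.+1 by lia.
  exact: add_letters_mono.
case: j E jr rj => [|j] E jr rj.
  exists LL; last first.
    have -> : i.-1 = (letters l).-1 by lia.
    exact: assoc_le_prod (left_comb_le _) (assoc_le_refl _).
  have := left_comb_le r.
  have -> : (letters r).-1 = (letters r).-1 - 1 + 1 by lia.
  by rewrite left_combE add_lettersD addnK.
exists (Prod (left_comb j) LL); first exact: (IHr j.+1 isT rj).
apply: assoc_le_trans (assoc_le_rot _ _ _).
apply: assoc_le_prod (assoc_le_refl _).
have := left_comb_le (Prod l (left_comb j)).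
rewrite /= (eqP (letters_left_comb _)).
by have -> : (letters l + j.+1).-1 = i.-1 by lia.
Qed.

(** * The Galois connection on the Tamari lattice *)

Section GaloisConnection.
Variable m : nat.

(** The shift skips the first flag, which is always true: 'I_m indexes the
    entries v_2, ..., v_(m+1) of the bracket vector. *)
Definition leaf_set (x : tamari m.+1) : {set 'I_m} :=
  [set k : 'I_m | nth false (left_leaves x) k.+1].

Definition set_flags (B : {set 'I_m}) := [seq k \in B | k <- enum 'I_m].

Lemma letters_set_tree B : letters (flag_tree (true :: set_flags B)) == m.+2.
Proof.
by rewrite /= letters_comb_row size_map size_enum_ord /= add1n addn1.
Qed.

Definition set_tree B : tamari m.+1 := Tamari (letters_set_tree B).

Lemma leaf_setE (x : tamari m.+1) :
  left_leaves x = true :: set_flags (leaf_set x).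
Proof.
have sz : size (left_leaves x) = m.+1.
  by rewrite size_left_leaves (eqP (valP x)).
apply: (@eq_from_nth _ false) => [|[|i]]; rewrite sz.
- by rewrite /= size_map size_enum_ord.
- move=> _; case: (x : paren) sz => // l r.
  by have [s ->] := left_leaves_Prod l r.
- rewrite ltnS => im; rewrite /= (nth_map (Ordinal im)) ?size_enum_ord //.
  by rewrite inE nth_enum_ord.
Qed.

Lemma left_leaves_set_tree B : left_leaves (set_tree B) = true :: set_flags B.
Proof. by rewrite left_leaves_comb_row /= cats0. Qed.

Lemma set_treeK : cancel set_tree leaf_set.
Proof.
move=> B; have := leaf_setE (set_tree B); rewrite left_leaves_set_tree.
case=> e; apply/setP => k.
by move/eq_in_map: e => /(_ k) -> //; rewrite mem_enum.
Qed.

Lemma below_set_flags (A B : {set 'I_m}) :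
  below_flags (true :: set_flags A) (true :: set_flags B) = (A \subset B).
Proof.
rewrite /= /below_flags /set_flags.
have -> s : all2 implb [seq k \in A | k <- s] [seq k \in B | k <- s]
    = all (fun k => (k \in A) ==> (k \in B)) s by elim: s => //= k s ->.
apply/allP/subsetP => AB k; last by move=> _; apply/implyP/AB.
by apply/implyP/AB; rewrite mem_enum.
Qed.

Lemma le_set_tree x B : (x <= set_tree B)%O = (leaf_set x \subset B).
Proof.
rewrite -below_set_flags -leaf_setE -left_leaves_set_tree.
apply/tamari_leP/idP; first exact: left_leaves_mono.
by rewrite left_leaves_set_tree; apply: le_flag_tree.
Qed.

Lemma set_tree0 : set_tree set0 = \bot%O.
Proof.
apply: val_inj; rewrite /= /set_flags.
have -> : [seq k \in set0 | k <- enum 'I_m] = nseq m false.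
  rewrite -[m in RHS]size_enum_ord; elim: (enum _) => //= k s ->.
  by rewrite in_set0.
by rewrite comb_row_nseq_false -left_combE.
Qed.

Lemma letters_atom k : letters (atom_tree m.+1 (k : 'I_m).+1) == m.+2.
Proof. by rewrite letters_atom_tree ?ltnS ?ltn_ord. Qed.

Definition tamari_atom k : tamari m.+1 := Tamari (letters_atom k).

Lemma tamari_atom_le k x : (tamari_atom k <= x)%O = (k \in leaf_set x).
Proof.
apply/tamari_leP/idP => [/left_leaves_mono|].
  have /= a := @nth_left_leaves_atom_tree m.+1 k.+1 isT.
  have sz := size_left_leaves (tamari_atom k).
  rewrite below_flags_nth inE => /andP[_ /allP/(_ k.+1)].
  rewrite a; apply; rewrite mem_iota sz (eqP (letters_atom k)) /=.
  by have := ltn_ord k; lia.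
rewrite inE => kx; have := atom_tree_le (ltn0Sn k) kx.
by rewrite (eqP (valP x)).
Qed.

End GaloisConnection.

(** * The maximal chain *)

Definition fixed_entries k (v : seq nat) : seq bool :=
  [seq x.1 == x.2 | x <- zip v (iota k (size v))].

Lemma fixed_entries_cat k u v :
  fixed_entries k (u ++ v) = fixed_entries k u ++ fixed_entries (k + size u) v.
Proof.
rewrite /fixed_entries size_cat iotaD zip_cat ?size_iota //.
by rewrite map_cat.
Qed.

Lemma size_bracket_seq k t : size (bracket_seq k t) = (letters t).-1.
Proof.
elim: t k => //= l IHl r IHr k; rewrite size_cat /= IHl IHr.
by have := letters_gt0 l; have := letters_gt0 r; lia.
Qed.

Lemma left_leaves_bracket k t :
  0 < k -> left_leaves t = fixed_entries k (bracket_seq k t).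
Proof.
elim: t k => // l IHl r IHr k k0; rewrite /= fixed_entries_cat -IHl //.
congr (_ ++ _); rewrite size_bracket_seq /fixed_entries /=; congr (_ :: _).
  have l0 := letters_gt0 l; case: l {IHl} l0 => /= [|a b] _.
    by rewrite addn0 !eqxx.
  have a0 := letters_gt0 a; have b0 := letters_gt0 b.
  by transitivity false => //; apply/esym/eqP; lia.
rewrite (IHr (k + letters l)) ?addn_gt0 ?k0 //.
by have -> : k + letters l = (k + (letters l).-1).+1
  by have := letters_gt0 l; lia.
Qed.

Lemma fixed_entries_iota k m : fixed_entries k (iota k m) = nseq m true.
Proof.
rewrite /fixed_entries size_iota; elim: m k => //= m IH k.
by rewrite eqxx IH.
Qed.

Lemma fixed_entries_nseq1 k m :
  1 < k -> fixed_entries k (nseq m 1) = nseq m false.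
Proof.
rewrite /fixed_entries size_nseq; elim: m k => //= m IH k k1.
by rewrite IH ?(leqW k1) // ltn_eqF.
Qed.

Lemma fixed_entries_delta n j i : 1 < j ->
  fixed_entries 1 (delta_vector n j i)
  = nseq (j.-1 + (i == j)) true ++ nseq (n - j + (i != j)) false.
Proof.
move=> j1; rewrite fixed_entries_cat fixed_entries_iota size_iota.
have -> : 1 + j.-1 = j by lia.
rewrite -cat1s fixed_entries_cat fixed_entries_nseq1 ?addn1; last by lia.
rewrite nseqD -catA; congr (_ ++ _).
by rewrite /fixed_entries /=; case: eqP => _; rewrite ?addn0 ?addn1.
Qed.

(** On the vectors of the chain the k with v_k = k form an initial segment
    ([delta_vectors_ramp]), so this number determines them. *)
Definition front (v : seq nat) := count id (fixed_entries 1 v).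

Lemma delta_vectors_ramp n v : 0 < n -> v \in delta_vectors n ->
  forall i, nth false (fixed_entries 1 v) i = (i < front v).
Proof.
have ramp a b i : nth false (nseq a true ++ nseq b false) i
    = (i < count id (nseq a true ++ nseq b false)).
  rewrite count_cat !count_nseq mul1n mul0n addn0 nth_cat size_nseq !nth_nseq.
  by case: ltnP => _; rewrite ?if_same.
case: n => // n _; rewrite inE /front => /orP[/eqP->|].
  rewrite -[nseq _ _]/([:: 1] ++ nseq n 1).
  rewrite fixed_entries_cat fixed_entries_nseq1 //.
  exact: (ramp 1 n).
case/allpairsPdep=> j [i [hj hi ->]].
by rewrite fixed_entries_delta //; move: hj; rewrite mem_iota; case/andP.
Qed.

(** The vectors (1, ..., j-1, i, 1, ..., 1) with 2 <= i < j have front j - 1,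
    and the one with i = j has front j. *)
Lemma front_delta_vectors n : 0 < n ->
  [seq front v | v <- delta_vectors n]
  = 1 :: flatten [seq rcons (nseq j.-2 j.-1) j | j <- iota 2 n.-1].
Proof.
case: n => // n _; rewrite /delta_vectors map_cons.
congr (_ :: _).
  rewrite /front -[nseq _ _]/([:: 1] ++ nseq n 1).
  rewrite fixed_entries_cat fixed_entries_nseq1 //.
  by rewrite count_cat count_nseq mul0n.
rewrite map_flatten -map_comp; congr flatten; apply/eq_in_map => j.
rewrite mem_iota => /andP[j1 _] /=; rewrite -map_comp.
have {1}-> : j.-1 = j.-2 + 1 by lia.
rewrite iotaD map_cat /= -cats1; congr (_ ++ [:: _]).
  rewrite -[in RHS](size_iota 2 j.-2).
  rewrite -[size _](size_map (front \o delta_vector n.+1 j)).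
  apply/all_pred1P; rewrite all_map; apply/allP => i; rewrite mem_iota => hi /=.
  rewrite /front fixed_entries_delta // count_cat !count_nseq.
  have -> : (i == j) = false by apply/eqP; lia.
  by rewrite /= mul1n mul0n !addn0 eqxx.
have -> : 2 + j.-2 = j by lia.
by rewrite /front fixed_entries_delta // eqxx count_cat !count_nseq; lia.
Qed.

Lemma front_path j m
    (s := flatten [seq rcons (nseq j.-2 j.-1) j | j <- iota j m]) :
  1 < j -> path (fun a b => a <= b <= a.+1) j.-1 s /\ last j.-1 s = j.-1 + m.
Proof.
rewrite {}/s; elim: m j => [|m IH] j j1 /=; first by rewrite addn0.
have [/= p l] := IH j.+1 (ltnW j1).
rewrite cat_path last_cat last_rcons l p andbT rcons_path.
have -> : last j.-1 (nseq j.-2 j.-1) = j.-1 by elim: j.-2.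
split; last by lia.
apply/andP; split; last by lia.
by elim: j.-2 => //= a ->; lia.
Qed.

Lemma nth_chain m i (D := delta_chain m.+1) : i < size D ->
  leaf_set (nth \bot%O D i)
  = [set k : 'I_m | k.+1 < nth 0 [seq front v | v <- delta_vectors m.+1] i].
Proof.
move=> iD; apply/setP => k; rewrite !inE.
rewrite (@left_leaves_bracket 1) // -left_bracket_vectorE.
have iV : i < size (delta_vectors m.+1).
  by rewrite -left_bracket_vector_chain size_map.
rewrite (nth_map [::]) // (@delta_vectors_ramp m.+1) //
  -?left_bracket_vector_chain.
  by rewrite (nth_map \bot%O).
exact/map_f/mem_nth.
Qed.

Lemma generalized_rank_chain m (x : tamari m.+1) :
  generalized_rank (delta_chain m.+1) x = #|leaf_set x|.
Proof.
have rank := generalized_rank_At (@le_set_tree m) (@set_treeK m) (@set_tree0 m)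
  (@tamari_atom_le m).
have eF := @front_delta_vectors m.+1 isT.
have [stepF lastF] := @front_path 2 m isT.
have sF :
    size (delta_chain m.+1) = size [seq front v | v <- delta_vectors m.+1].
  by rewrite -left_bracket_vector_chain !size_map.
set F := [seq front v | v <- _] in eF sF *.
have D0 : chain_length (delta_chain m.+1) < size (delta_chain m.+1).
  by rewrite /chain_length sF eF.
apply: rank => [||i iN].
- by rewrite nth_chain ?sF ?eF //; apply/setP => k; rewrite !inE -/F eF.
- rewrite nth_chain // -/F /chain_length sF nth_last eF [last _ _]lastF.
  by apply/setP => k; rewrite !inE /= add1n ltnS ltn_ord.
have iD : i.+1 < size (delta_chain m.+1) by apply: leq_ltn_trans iN D0.
have /andP[Fle Fge] : nth 0 F i <= nth 0 F i.+1 <= (nth 0 F i).+1.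
  rewrite eF; apply: (pathP 0 stepF).
  by rewrite sF eF in iD.
rewrite !nth_chain -/F //; last exact: ltnW.
split; first by apply/subsetP => k; rewrite !inE => /leq_trans; apply.
apply/card_le1_eqP => k l; rewrite !inE -!leqNgt => /andP[k1 k2] /andP[l1 l2].
by apply: val_inj => /=; lia.
Qed.

Theorem corollary7p3 (n : nat) (hn : (1 <= n)%N) :
  characteristic_poly (delta_chain n) =
    ('X^('C(n.-1, 2)) * ('X - 1) ^+ n.-1)%R :> {poly int}.
Proof.
case: n hn => // m _; rewrite /characteristic_poly chain_length_delta.
have binE : 'C(m.+1, 2) = 'C(m, 2) + m by rewrite binS bin1.
under eq_bigr do rewrite generalized_rank_chain.
rewrite (sum_mobius_adjoint (@le_set_tree m) (@set_treeK m) (@set_tree0 m));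
  rewrite card_ord binE ?leq_addl //.
by rewrite addnK.
Qed.
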